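(* Let $I\subset(0,\infty)$ be a closed bounded interval, let $J\subseteq\mathbb{R}$ with $[0,1]\subseteq J$, let $h:J\to\mathbb{R}$ be a nonnegative function, and let $f:I\to(0,\infty)$ be an $h$-geometrically convex function on $I$. Then for every $x,y\in I$ with $x<y$, $$\frac{1}{\ln y-\ln x}\int_x^y f(\gamma)f\left(\frac{xy}{\gamma}\right)\frac{d\gamma}{\gamma}\le \int_0^1 [f(x)f(y)]^{h(t)+h(1-t)}dt.$$
   Context: A positive function $f$ on an interval $I\subset(0,\infty)$ is called $h$-geometrically convex if for all $x,y\in I$ and $t\in[0,1]$, $f(x^t y^{1-t})\le [f(x)]^{h(t)}[f(y)]^{h(1-t)}$, where $h:J\to\mathbb{R}$ is a nonnegative function on $J\subseteq\mathbb{R}$. *)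

(* Defs.v *)
From mathcomp Require Import all_boot all_order all_algebra.
From mathcomp Require Import all_classical all_reals all_analysis.

Set Implicit Arguments.
Unset Strict Implicit.
Unset Printing Implicit Defensive.

Import Order.TTheory GRing.Theory Num.Theory.
Import numFieldNormedType.Exports.

Local Open Scope classical_set_scope.
Local Open Scope ring_scope.

(* Partial functions f : I -> R and h : J -> R are represented by total
   functions R -> R; only the values of f on I and of h on [0, 1] occur (I is
   an interval, hence closed under weighted geometric means).  The notion is
   meant for I included in ]0, +oo[ and f positive on I, where `^ is the usual
   real power. *)
Definition h_geometrically_convex (R : realType) (h : R -> R) (I : set R)
    (f : R -> R) : Prop :=
  forall x y t : R, I x -> I y -> `[0, 1]%classic t ->
    f (x `^ t * y `^ (1 - t)) <= f x `^ h t * f y `^ h (1 - t).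

(* Main.v *)
(* With g = x^(1-t) y^t, so that x y / g = x^t y^(1-t) and dg/g = (ln y - ln x) dt,
   the left-hand side becomes the integral over [0, 1] of f(g) f(x y / g), and
   multiplying the convexity inequalities for (x, y, t) and (y, x, t) bounds this
   integrand by that of the right-hand side.
   As f and h need not be measurable, the integrals are lower ones, i.e., suprema
   over simple functions below the integrand.  The substitution is therefore
   carried out on a simple function below the left integrand; for those it
   amounts to the equality of two measures that agree on closed rays. *)
From HB Require Import structures.
Require Import Defs.
From mathcomp Require Import all_boot all_order all_algebra.
From mathcomp Require Import all_classical all_reals all_analysis.
From mathcomp Require Import measurable_realfun ring.

Set Implicit Arguments.
Unset Strict Implicit.
Unset Printing Implicit Defensive.

Import Order.TTheory GRing.Theory Num.Theory.
Import numFieldNormedType.Exports.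
Import HBNNSimple.

Local Open Scope classical_set_scope.
Local Open Scope ring_scope.

(** The integral of a nonnegative function is a supremum over the simple functions below its
    extension by 0 off [D]. Such a simple function vanishes off [D], so restricting its integral to
    [D] loses nothing. *)
Lemma ge0_integral_le_lower d (T : measurableType d) (R : realType)
    (mu : {measure set T -> \bar R}) (D : set T) (f : T -> \bar R) (c : \bar R) :
  (forall x, D x -> (0 <= f x)%E) ->
  (forall s : {nnsfun T >-> R}, (forall x, D x -> ((s x)%:E <= f x)%E) ->
    (\int[mu]_(x in D) (s x)%:E <= c)%E) ->
  (\int[mu]_(x in D) f x <= c)%E.
Proof.
move=> f0 sc; rewrite ge0_integralE//; apply: ge_ereal_sup => _ [s /= sf <-].
rewrite -integralT_nnsfun.
have sE : (fun x => (s x)%:E) \_ D = EFin \o s.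
  apply/funext => x; rewrite patchE; case: ifPn => //= xD.
  have := sf x; rewrite patchE (negbTE xD) lee_fin => sx0.
  by apply/eqP; rewrite eqe eq_le sx0 andbT.
rewrite -[X in integral _ _ X]sE -integral_mkcond; apply: sc => x Dx.
by have := sf x; rewrite patchE mem_set.
Qed.

(** Every simple function below [f] is also below [g], so the second supremum runs over a larger
    set. *)
Lemma ge0_le_integral_nonmeasurable d (T : measurableType d) (R : realType)
    (mu : {measure set T -> \bar R}) (D : set T) (f g : T -> \bar R) :
  (forall x, D x -> (0 <= f x)%E) -> (forall x, D x -> (f x <= g x)%E) ->
  (\int[mu]_(x in D) f x <= \int[mu]_(x in D) g x)%E.
Proof.
move=> f0 fg; rewrite !ge0_integralE//; last first.
  by move=> x Dx; rewrite (le_trans (f0 _ Dx))// fg.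
apply: ereal_sup_le => _ [s /= sf <-]; exists s => // x.
by rewrite (le_trans (sf x))// lee_restrict.
Qed.

(** Image under [F] of the measure on [[a, b]] with density [derive1 F], named so that it can
    receive a measure structure. *)
Definition derive1_pullback {R : realType} (F : R -> R) (a b : R)
    (A : set (measurableTypeR R)) : \bar R :=
  (\int[@lebesgue_measure R]_(t in `[a, b] `&` F @^-1` A) (derive1 F t)%:E)%E.

Section measurable_substitution.
Context {R : realType} (F : R -> R) (a b : R).
Hypothesis leab : a <= b.
Hypothesis Finc : {homo F : x y / x < y}.
Hypothesis dF : forall x, derivable F x 1.
Hypothesis cF' : continuous (derive1 F).
Local Notation mu := (@lebesgue_measure R).

Let cF : continuous F.
Proof.
by move=> x; apply/differentiable_continuous/derivable1_diffP; exact: dF.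
Qed.

Let mF : measurable_fun setT F.
Proof. exact: continuous_measurable_fun. Qed.

Let F'_ge0 x : 0 <= derive1 F x.
Proof.
apply: (@incr_derive1_ge0 _ _ setT).
- by move=> ? _; exact: dF.
- by move=> ? ? _ _; exact: Finc.
- by rewrite interiorT.
Qed.

Let mF' : measurable_fun setT (derive1 F).
Proof. exact: continuous_measurable_fun. Qed.

Let Fle : {mono F : x y / x <= y}.
Proof. exact/le_mono. Qed.

Local Notation pullback := (derive1_pullback F a b).

Let pullback0 : pullback set0 = 0%E.
Proof. by rewrite /derive1_pullback preimage_set0 setI0 integral_set0. Qed.

Let pullback_ge0 A : (0 <= pullback A)%E.
Proof. by apply: integral_ge0 => t _; rewrite lee_fin. Qed.

Let mpre (A : set (measurableTypeR R)) : measurable A ->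
  measurable (F @^-1` A : set (measurableTypeR R)).
Proof. by move=> mA; rewrite -[X in measurable X]setTI; exact: mF. Qed.

Let pullback_sigma_additive : semi_sigma_additive pullback.
Proof.
move=> A mA tA mUA; rewrite /derive1_pullback preimage_bigcup setI_bigcupr.
rewrite ge0_integral_bigcup//=.
- apply: is_cvg_ereal_nneg_natsum => n _; exact: pullback_ge0.
- by move=> k; apply: measurableI => //; exact: mpre.
- by apply/measurable_EFinP; exact: measurable_funTS.
- by move=> x _; rewrite lee_fin.
- apply/trivIsetP => i j _ _ ij; rewrite setIACA setIid -preimage_setI.
  move/trivIsetP : tA => /(_ i j Logic.I Logic.I ij) ->.
  by rewrite preimage_set0 setI0.
Qed.

HB.instance Definition _ := isMeasure.Build _ (measurableTypeR R) R pullback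
  pullback0 pullback_ge0 pullback_sigma_additive.

(** Substitution for continuous integrands, applied to the constant 1; it supplies the values of
    [pullback] on closed rays. *)
Let lebesgue_itv_substitution t : t <= b ->
  (\int[mu]_(u in `[t, b]) (derive1 F u)%:E)%E = mu `[F t, F b].
Proof.
move=> tb; rewrite -[RHS]mul1e -integral_cst//.
rewrite (@integration_by_substitution_increasing R F (cst 1) t b tb).
- by apply: eq_integral => u _; rewrite fctE/= mul1r.
- by move=> ? ? _ _; exact: Finc.
- by move=> ? _; exact: cF'.
- by apply/cvg_ex; exists (derive1 F t); apply: cvg_at_right_filter; exact: cF'.
- by apply/cvg_ex; exists (derive1 F b); apply: cvg_at_left_filter; exact: cF'.
- split=> [? _||]; first exact: dF.
    by apply: cvg_at_right_filter; exact: cF.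
  by apply: cvg_at_left_filter; exact: cF.
- by apply: continuous_subspaceT => ?; exact: cvg_cst.
Qed.

(** As functions of [A], both sides are measures. They agree on the closed rays [[c, +oo[], which
    are stable under intersection and generate the Borel sets, and they are finite there, so they
    coincide. *)
Lemma lebesgue_measure_substitution (A : set (measurableTypeR R)) :
  measurable A ->
  (mu (A `&` `[F a, F b]) =
   \int[mu]_(t in `[a, b] `&` F @^-1` A) (derive1 F t)%:E)%E.
Proof.
pose m1 : {measure set (measurableTypeR R) -> \bar R} :=
  mrestr mu (measurable_itv `[F a, F b]).
pose m2 : {measure set (measurableTypeR R) -> \bar R} := pullback.
move=> mA; change (m1 A = m2 A); move: A mA.
refine (@measure_unique _ R (measurableTypeR R) (@RGenCInfty.G R)
  (fun n => `[- n%:R, +oo[%classic) _ _ _ _ m1 m2 _ _).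
- exact: RGenCInfty.measurableE.
- move=> _ _ [x ->] [y ->]; exists (Num.max x y).
  by apply/seteqP; split => z /=; rewrite !in_itv/= !andbT ge_max => /andP.
- by move=> n; exists (- n%:R).
- apply/seteqP; split => // x _; exists (Num.bound `|x|) => //=.
  rewrite in_itv/= andbT lerNl (le_trans (ler_norm _))//.
  by rewrite normrN ltW// archi_boundP.
- move=> _ [c ->].
  change (mu (`[c, +oo[ `&` `[F a, F b]) = pullback `[c, +oo[).
  rewrite /derive1_pullback.
  have [Fbc|cFb] := ltP (F b) c.
    rewrite [X in mu X](_ : _ = set0) ?measure0; last first.
      apply/seteqP; split => // x [] /=; rewrite !in_itv/= andbT => cx /andP[_].
      by move=> /(le_trans cx); rewrite leNgt Fbc.
    rewrite [X in integral _ X](_ : _ = set0) ?integral_set0//.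
    apply/seteqP; split => // x [] /=; rewrite !in_itv/= andbT => /andP[_ xb].
    by move=> /le_trans/(_ _); rewrite -Fle in xb => /(_ _ xb); rewrite leNgt Fbc.
  (* Raising [c] to at least [F a] puts it in the range of [F] on [[a, b]]. With [t] its preimage,
     the two truncated sets become [[F t, F b]] and [[t, b]]. *)
  have [|t tab Ft] := @IVT R F a b (Num.max c (F a)) leab (continuous_subspaceT cF).
    have Fab : F a <= F b by rewrite Fle.
    by rewrite (min_idPl Fab) (max_idPr Fab) le_max lexx orbT/= ge_max cFb.
  rewrite [X in mu X](_ : _ = `[F t, F b]%classic); last first.
    apply/seteqP; split => x /=; rewrite !in_itv/= andbT Ft ge_max.
      by move=> [-> /andP[-> ->]].
    by move=> /andP[/andP[-> ->] ->].
  rewrite [X in integral _ X](_ : _ = `[t, b]%classic).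
    by rewrite lebesgue_itv_substitution// (itvP tab).
  apply/seteqP; split => x /=; rewrite !in_itv/= andbT -[t <= x]Fle Ft ge_max Fle.
    by move=> [/andP[-> ->] ->].
  by move=> /andP[/andP[-> ->] ->].
- move=> k; rewrite (@le_lt_trans _ _ (mu `[F a, F b]))//.
    by apply: le_measure; rewrite ?inE//; exact: measurableI.
  by rewrite lebesgue_measure_itv/=; case: ifP; rewrite ?ltry// -EFinB ltry.
Qed.

(** By linearity this reduces to the level sets of [s], where it is the equality of measures just
    proved. *)
Lemma integral_nnsfun_substitution (s : {nnsfun measurableTypeR R >-> R}) :
  (\int[mu]_(x in `[F a, F b]) (s x)%:E =
   \int[mu]_(t in `[a, b]) (s (F t) * derive1 F t)%:E)%E.
Proof.
have ms y : measurable (s @^-1` [set y] : set (measurableTypeR R)).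
  exact: measurable_funPTI.
have msF y : measurable_fun (`[a, b] : set (measurableTypeR R))
    (fun t => \1_(s @^-1` [set y]) (F t) : R).
  have -> : (fun t => \1_(s @^-1` [set y]) (F t) : R) =
      \1_(F @^-1` (s @^-1` [set y])) by apply/funext => t; rewrite !indicE.
  by apply: measurable_indic; exact: mpre.
transitivity (\sum_(y \in range s)
    (y%:E * mu (s @^-1` [set y] `&` `[F a, F b])))%E.
  under eq_integral do rewrite fimfunE -fsumEFin//.
  rewrite ge0_integral_fsum//.
  - apply: eq_fsbigr => y; rewrite inE => -[x _ <-].
    under eq_integral do rewrite EFinM.
    rewrite ge0_integralZl//.
    + by rewrite integral_indic.
    + by apply/measurable_EFinP; exact: measurable_indic.
    + by rewrite lee_fin.
  - move=> y; apply/measurable_EFinP; exact: measurable_funM.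
  - by move=> y x _; rewrite EFinM; exact: nnfun_muleindic_ge0.
under [RHS]eq_integral do rewrite fimfunE mulr_fsuml -fsumEFin//.
rewrite [RHS]ge0_integral_fsum//.
- apply: eq_fsbigr => y; rewrite inE => -[x _ <-].
  under [RHS]eq_integral do rewrite -mulrA EFinM.
  rewrite [RHS]ge0_integralZl//.
  + rewrite lebesgue_measure_substitution// integral_mkcondr; congr (_ * _)%E.
    apply: eq_integral => t _; rewrite patchE indicE.
    have [Ft|Ft] := boolP (F t \in _).
      by rewrite mem_set ?mul1r//; move: Ft; rewrite inE.
    by rewrite memNset ?mul0r// => sFt; move: Ft; rewrite mem_set.
  + by apply/measurable_EFinP/measurable_funM => //; exact: measurable_funTS.
  + by move=> ? _; rewrite lee_fin mulr_ge0.
  + by rewrite lee_fin.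
- move=> y; apply/measurable_EFinP/measurable_funM.
    exact: measurable_funM.
  exact: measurable_funTS.
- by move=> y t _; rewrite EFinM mule_ge0 ?lee_fin//; exact: nnfun_muleindic_ge0.
Qed.

End measurable_substitution.

(** Multiply the convexity inequalities for [(y, x, t)] and [(x, y, t)]: both [f x] and [f y]
    collect the exponents [h t] and [h (1 - t)]. The two sign hypotheses permit this product; [I] is
    an arbitrary set here, so it need not contain the geometric means. *)
Lemma h_geometrically_convex_mul (R : realType) (h : R -> R) (I : set R)
    (f : R -> R) (x y t : R) :
  h_geometrically_convex h I f -> (forall z, I z -> 0 < f z) ->
  I x -> I y -> `[0, 1]%classic t ->
  0 <= f (x `^ t * y `^ (1 - t)) -> 0 <= f (y `^ t * x `^ (1 - t)) ->
  f (y `^ t * x `^ (1 - t)) * f (x `^ t * y `^ (1 - t)) <=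
    (f x * f y) `^ (h t + h (1 - t)).
Proof.
move=> f_conv f_gt0 Ix Iy t01 fxy_ge0 fyx_ge0.
have fx0 := f_gt0 _ Ix; have fy0 := f_gt0 _ Iy.
rewrite (@powRD _ (f x * f y)); last by rewrite mulf_neq0 ?implybT// gt_eqF.
rewrite !(@powRM _ (f x) (f y) _ (ltW fx0) (ltW fy0)).
apply: le_trans (ler_pM fyx_ge0 fxy_ge0 (f_conv _ _ _ Iy Ix t01)
  (f_conv _ _ _ Ix Iy t01)) _.
by rewrite mulrACA [X in X * _ <= _]mulrC.
Qed.

(* The integrals are Lebesgue integrals of nonnegative functions, with values
   in [0, +oo]; no integrability is assumed. *)
Theorem theorem5 (R : realType) (a b : R) (J : set R) (h f : R -> R)
    (a_gt0 : 0 < a) (ab : a <= b)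
    (J01 : `[0, 1] `<=` J)
    (h_ge0 : forall t : R, J t -> 0 <= h t)
    (f_gt0 : forall x : R, `[a, b]%classic x -> 0 < f x)
    (f_conv : h_geometrically_convex h `[a, b] f)
    (x y : R) (Ix : `[a, b]%classic x) (Iy : `[a, b]%classic y) (xy : x < y) :
  (((ln y - ln x)^-1)%:E *
     \int[@lebesgue_measure R]_(g in `[x, y]) (f g * f (x * y / g) / g)%:E
   <= \int[@lebesgue_measure R]_(t in `[0%R, 1%R])
        ((f x * f y) `^ (h t + h (1 - t)))%:E)%E.
Proof.
have x0 : 0 < x by move: Ix; rewrite /= in_itv/= => /andP[/(lt_le_trans a_gt0)].
have y0 : 0 < y := lt_trans x0 xy.
have L0 : 0 < ln y - ln x by rewrite subr_gt0 ltr_ln.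
have xyI g : x <= g <= y -> `[a, b]%classic g.
  move: Ix Iy; rewrite /= !in_itv/= => /andP[ax _] /andP[_ yb] /andP[xg gy].
  by rewrite (le_trans ax)//= (le_trans gy).
(* The involution [g] to [x * y / g] preserves [[x, y]], so both factors of the integrand are values
   of [f] on [[a, b]]. *)
have swapI g : x <= g <= y -> x <= x * y / g <= y.
  move=> /andP[xg gy]; have g0 := lt_le_trans x0 xg.
  by rewrite ler_pdivlMr// ler_pdivrMr// ler_pM2l// mulrC ler_pM2l// gy xg.
(* The geometric path from [x] to [y], in exponential form so that its derivative is
   [(ln y - ln x) * F t]. *)
pose F t := x * expR ((ln y - ln x) * t).
have F0 : F 0 = x by rewrite /F mulr0 expR0 mulr1.
have F1 : F 1 = y by rewrite /F mulr1 expRB !lnK// mulrCA divff ?mulr1 ?gt_eqF.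
have Fgt0 t : 0 < F t by rewrite mulr_gt0// expR_gt0.
have FE t : F t = y `^ t * x `^ (1 - t).
  rewrite /F /powR !gt_eqF// -expRD -{1}(lnK x0) -expRD; congr expR; ring.
have powRK (z t : R) : 0 < z -> z `^ t * z `^ (1 - t) = z.
  move=> z0; rewrite -powRD; last by rewrite (gt_eqF z0) implybT.
  by rewrite addrC subrK powRr1// ltW.
have xyFE t : x * y / F t = x `^ t * y `^ (1 - t).
  apply: (canLR (mulfK (lt0r_neq0 (Fgt0 t)))); rewrite FE.
  by rewrite [X in _ = _ * X]mulrC mulrACA [X in _ = _ * X]mulrC !powRK.
have Finc : {homo F : t u / t < u}.
  by move=> t u tu; rewrite ltr_pM2l// ltr_expR ltr_pM2l.
have isF (t : R) : is_derive t (1 : R) F ((ln y - ln x) * F t).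
  have -> : F = x \*: (expR \o ((ln y - ln x) \*: id)) by [].
  apply: is_derive_eq => /=; rewrite /F !scaler1 /GRing.scale/=; ring.
have dF (t : R) : derivable F t (1 : R) by [].
have F'E : derive1 F = fun t => (ln y - ln x) * F t.
  by apply/funext => t; rewrite derive1E derive_val.
have cF : continuous F.
  by move=> t; apply/differentiable_continuous/derivable1_diffP.
have cF' : continuous (derive1 F).
  by rewrite F'E => t; apply: cvgM; [exact: cvg_cst|exact: cF].
rewrite lee_pdivrMl//.
apply: ge0_integral_le_lower => // [g|s sf].
  rewrite /= in_itv/= => xgy; rewrite lee_fin divr_ge0 ?mulr_ge0 ?ltW ?f_gt0//.
  - exact: xyI.
  - by apply/xyI/swapI.
  - by move/andP : xgy => [/(lt_le_trans x0)].
rewrite -[in leLHS]F0 -[in leLHS]F1 integral_nnsfun_substitution//.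
(* The constant [ln y - ln x] can now leave the integral: what remains involves only [s] and [F],
   hence is measurable. *)
under eq_integral do rewrite F'E mulrCA EFinM.
rewrite ge0_integralZl//.
- apply: lee_wpmul2l; first by rewrite lee_fin ltW.
  apply: ge0_le_integral_nonmeasurable => t t01.
    by rewrite lee_fin mulr_ge0// ltW.
  have xFy : x <= F t <= y.
    rewrite -F0 -F1 !(le_mono Finc).
    by move: t01; rewrite /= in_itv.
  (* The factor [F t] coming from the derivative cancels the division by [g = F t] in the bound on
     [s]. *)
  rewrite lee_fin (@le_trans _ _ (f (F t) * f (x * y / F t)))//.
    by rewrite -ler_pdivlMr// -lee_fin; apply: sf.
  rewrite xyFE FE; apply: (h_geometrically_convex_mul f_conv) => //.
    by rewrite -xyFE ltW// f_gt0//; apply/xyI/swapI.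
  by rewrite -FE ltW// f_gt0//; exact: xyI.
- apply/measurable_EFinP/measurable_funM; last first.
    by apply: measurable_funTS; exact: continuous_measurable_fun.
  apply: (@measurableT_comp _ _ _ _ (measurableTypeR R) R s) => //.
  by apply: measurable_funTS; exact: continuous_measurable_fun.
- by move=> t _; rewrite lee_fin mulr_ge0// ltW.
- by rewrite lee_fin ltW.
Qed.
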